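(* Let $\mathbb{X},\mathbb{U},\mathbb{V}$ be real Hilbert spaces, let $a(\xi;\cdot,\cdot)\in\mathcal{L}(\mathbb{V}\times\mathbb{V};\mathbb{R})$ be a continuous bilinear form for each $\xi\in\mathbb{X}$, and let $b(\cdot,\cdot)\in\mathcal{L}(\mathbb{U}\times\mathbb{V};\mathbb{R})$ be a continuous bilinear form. Let $\mathbb{U}_h\subset\mathbb{U}$ be a finite-dimensional subspace, $\hat{\mathbb{V}}\subseteq\mathbb{V}$ a closed subspace, and $$\hat{\mathbb{K}}:=\{v\in\hat{\mathbb{V}}: b(w_h,v)=0\ \ \forall w_h\in\mathbb{U}_h\}.$$ For $\xi\in\mathbb{X}$ and $f\in\mathbb{V}^*$ consider the problem: find $(r,u_h)\in\hat{\mathbb{V}}\times\mathbb{U}_h$ such that $$(\mathrm{P})\qquad a(\xi;r,v)+b(u_h,v)=f(v)\ \ \forall v\in\hat{\mathbb{V}},\qquad b(w_h,r)=0\ \ \forall w_h\in\mathbb{U}_h.$$ Then: (i) For each $\xi\in\mathbb{X}$, problem (P) is well-posed (for any $f\in\mathbb{V}^*$) if and only if there exist constants $\alpha_h=\alpha_h(\xi)>0$ and $\beta_h>0$ such that $$(\mathrm{A})\qquad \inf_{v_1\in\hat{\mathbb{K}}}\sup_{v_2\in\hat{\mathbb{K}}}\frac{a(\xi;v_1,v_2)}{\|v_1\|_{\mathbb{V}}\|v_2\|_{\mathbb{V}}}\ge\alpha_h,\qquad \{v_2\in\hat{\mathbb{K}}: a(\xi;v_1,v_2)=0\ \forall v_1\in\hat{\mathbb{K}}\}=\{0\},$$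 $$(\mathrm{B})\qquad \inf_{w_h\in\mathbb{U}_h}\sup_{v\in\hat{\mathbb{V}}}\frac{b(w_h,v)}{\|w_h\|_{\mathbb{U}}\|v\|_{\mathbb{V}}}\ge\beta_h .$$ (ii) If (A) and (B) are satisfied, then the solution component $u_h\in\mathbb{U}_h$ of (P) satisfies $$\|u_h\|_{\mathbb{U}}\le\frac1{\beta_h}\left(1+\frac{\|a(\xi;\cdot,\cdot)\|_{\mathcal{L}(\mathbb{V}\times\mathbb{V};\mathbb{R})}}{\alpha_h}\right)\|f\|_{\mathbb{V}^*}.$$ (iii) Furthermore, if $a(\xi;\cdot,\cdot)$ is an equivalent inner product on $\mathbb{V}$, with associated norm $\|\cdot\|_{\mathbb{V},\xi}:=\sqrt{a(\xi;\cdot,\cdot)}$, i.e., for some $C_{1,\xi},C_{2,\xi}>0$, $$C_{1,\xi}\|v\|_{\mathbb{V}}\le\|v\|_{\mathbb{V},\xi}\le C_{2,\xi}\|v\|_{\mathbb{V}}\qquad\forall v\in\mathbb{V},$$ then (A) holds with $\alpha_h=(C_{1,\xi})^2$, and additionally (when (B) holds) the following improved a priori bound holds true: $$\|u_h\|_{\mathbb{U}}\le\frac{C_{2,\xi}}{C_{1,\xi}}\,\frac1{\beta_h}\,\|f\|_{\mathbb{V}^*}.$$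
   Context: Well-posed means: for every $f\in\mathbb{V}^*$ there is a unique solution $(r,u_h)\in\hat{\mathbb{V}}\times\mathbb{U}_h$, depending continuously on $f$. Infima and suprema of quotients are taken over nonzero elements. $\mathcal{L}(\mathbb{V}\times\mathbb{V};\mathbb{R})$ denotes continuous bilinear forms with norm $\|a\|=\sup|a(v_1,v_2)|/(\|v_1\|_{\mathbb{V}}\|v_2\|_{\mathbb{V}})$. *)

(* Defs.v *)
From HB Require Import structures.
From mathcomp Require Import all_boot all_order all_algebra.
From mathcomp Require Import all_classical all_reals all_analysis.

Set Implicit Arguments.
Unset Strict Implicit.
Unset Printing Implicit Defensive.

Import Order.TTheory GRing.Theory Num.Theory.
Import numFieldNormedType.Exports.

Local Open Scope classical_set_scope.
Local Open Scope ring_scope.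

HB.mixin Record isHilbert (R : realType) H of CompleteNormedModule R H := {
  inner : {dot H for (@idfun R)} ;
  inner_norm : forall x : H, inner x x = `|x| ^+ 2
}.

#[short(type="hilbertType")]
HB.structure Definition Hilbert (R : realType) :=
  {H of CompleteNormedModule R H & isHilbert R H}.

Section spaces.
Context {R : realType}.

Definition linear_subspace (V : lmodType R) (W : set V) : Prop :=
  submod_closed [in W].

Definition closed_subspace (V : normedModType R) (W : set V) : Prop :=
  linear_subspace W /\ closed W.

Definition finite_dim_subspace (V : lmodType R) (W : set V) : Prop :=
  exists (n : nat) (e : 'I_n -> V),
    W = [set \sum_(i < n) c i *: e i | c in [set: 'I_n -> R]].

Definition continuous_bilinear (U V : normedModType R)
    (c : {bilinear U -> V -> R}) : Prop :=
  continuous (fun p : U * V => c p.1 p.2).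

(* Meant for continuous c and f, whose quotients are bounded: [sup] of an
   unbounded set is 0. So is [sup set0], the right norm on a trivial space. *)
Definition bilinear_norm (U V : normedModType R) (c : U -> V -> R) : R :=
  sup [set x | exists u v, [/\ u != 0, v != 0 & x = `|c u v| / (`|u| * `|v|)]].

Definition dual_norm (V : normedModType R) (f : V -> R) : R :=
  sup [set `|f v| / `|v| | v in [set v | v != 0]].

(* In the extended reals, the infimum over the nonzero elements of a trivial
   subspace is +oo (in [R] it would be 0) and the supremum is -oo. *)
Definition infsup (U V : normedModType R) (c : U -> V -> R)
    (A : set U) (B : set V) : \bar R :=
  ereal_inf [set ereal_sup [set (c u v / (`|u| * `|v|))%:E | v in B `\ 0]
            | u in A `\ 0].

End spaces.

Section saddle_point.
Context {R : realType} {U V : normedModType R}.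
Variables (a : V -> V -> R) (b : U -> V -> R) (Uh : set U) (Vhat : set V).

Definition discrete_kernel : set V :=
  [set v | Vhat v /\ forall w, Uh w -> b w v = 0].

Definition solves (f : V -> R) (p : V * U) : Prop :=
  [/\ Vhat p.1, Uh p.2,
      forall v, Vhat v -> a p.1 v + b p.2 v = f v
    & forall w, Uh w -> b w p.1 = 0].

(* Well-posedness in the sense of Hadamard: the solution map from the dual of V,
   with its operator norm, to V * U is well defined and continuous. *)
Definition well_posed : Prop :=
  (forall f : {linear V -> R}, continuous f -> exists! p, solves f p) /\
  (forall (f : {linear V -> R}) (p : V * U), continuous f -> solves f p ->
   forall eps : R, 0 < eps -> exists2 delta : R, 0 < delta &
   forall (g : {linear V -> R}) (q : V * U), continuous g -> solves g q ->
     dual_norm (fun v => g v - f v) < delta -> `|q - p| < eps).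

Definition condA (alpha : R) : Prop :=
  (alpha%:E <= infsup a discrete_kernel discrete_kernel)%E /\
  [set v2 | discrete_kernel v2 /\
            forall v1, discrete_kernel v1 -> a v1 v2 = 0] = [set 0].

Definition condB (beta : R) : Prop := (beta%:E <= infsup b Uh Vhat)%E.

End saddle_point.

Definition energy_norm (R : realType) (V : lmodType R) (s : V -> V -> R)
    (v : V) : R := Num.sqrt (s v v).

Definition is_inner_product (R : realType) (V : lmodType R)
    (s : V -> V -> R) : Prop :=
  exists d : {dot V for (@idfun R)}, s =2 d.

Definition equivalent_inner_product (R : realType) (V : normedModType R)
    (s : V -> V -> R) (C1 C2 : R) : Prop :=
  [/\ is_inner_product s, 0 < C1, 0 < C2 &
      forall v : V, C1 * `|v| <= energy_norm s v <= C2 * `|v|].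

(* Main.v *)
Require Import Defs.
From HB Require Import structures.
From mathcomp Require Import all_boot all_order all_algebra.
From mathcomp Require Import all_classical all_reals all_analysis.
From mathcomp Require Import ring lra.

(* Riesz's theorem on closed subspaces comes from minimising a coercive
   quadratic functional. With it, (A) gives a unique [r] in the kernel by the
   Babuska-Necas argument, and [f - a r], which annihilates the kernel, is of the
   form [b u_h] because the kernel is cut out by finitely many functionals
   [b e_i]; (B) makes [u_h] unique and bounds it.
   Conversely, well-posedness yields by scaling a constant [C] with
   [|(r, u_h)| <= C |f|]. To test (B) at [w], apply it to the solution [(0, w)]
   for the Riesz representer [t] in [Vhat] of [b w]; to test (A) at [r], apply it
   to a solution [(r, u)] for the representer [t] in the kernel of [a r]. Passing
   to representers matters: it makes the norm of the data over the whole of [V]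
   equal to its norm over the subspace. *)

Set Implicit Arguments.
Unset Strict Implicit.
Unset Printing Implicit Defensive.

Import Order.TTheory GRing.Theory Num.Theory.
Import numFieldNormedType.Exports.

Local Open Scope classical_set_scope.
Local Open Scope ring_scope.

(** * Linear subspaces and functionals on them *)

Section subspaces.
Context {F : realType} {V : lmodType F}.
Implicit Type W : set V.

Lemma linear_subspaceP W : linear_subspace W <->
  W 0 /\ forall k x y, W x -> W y -> W (k *: x + y).
Proof.
split=> [[W0 WP]|[W0 WP]]; split.
- by move: W0; rewrite inE.
- move=> k x y Wx Wy; have := WP k x y.
  by rewrite !inE; apply.
- by rewrite inE.
- by move=> k x y; rewrite !inE; exact: WP.
Qed.

Lemma linear_subspaceD W x y : linear_subspace W -> W x -> W y -> W (x + y).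
Proof. by move=> /linear_subspaceP[_ WP] Wx /(WP 1 _ _ Wx); rewrite scale1r. Qed.

Lemma linear_subspaceZ W k x : linear_subspace W -> W x -> W (k *: x).
Proof. by move=> /linear_subspaceP[W0 WP] Wx; rewrite -[_ *: _]addr0; exact: WP. Qed.

Lemma linear_subspaceB W x y : linear_subspace W -> W x -> W y -> W (x - y).
Proof.
move=> sW Wx Wy; rewrite -[- y]scaleN1r.
by apply: linear_subspaceD => //; apply: linear_subspaceZ.
Qed.

(** Induction on [n]: on the part of [W] where the first functional vanishes, [g] is a combination
    of the others. The remainder [h] vanishes on that part, hence is a multiple of the first
    functional. *)
Lemma functional_sum n (phi : 'I_n -> {linear V -> F}) W (g : {linear V -> F}) :
  linear_subspace W ->
  (forall v, W v -> (forall i, phi i v = 0) -> g v = 0) ->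
  exists c : 'I_n -> F, forall v, W v -> g v = \sum_(i < n) c i * phi i v.
Proof.
elim: n phi W g => [|n IHn] phi W g sW gK.
  by exists (fun=> 0) => v Wv; rewrite big_ord0 gK// => -[].
have /linear_subspaceP[W0 WP] := sW.
pose W' := [set v | W v /\ phi ord0 v = 0].
have sW' : linear_subspace W'.
  apply/linear_subspaceP; split; first by split=> //; rewrite linear0.
  move=> k x y [Wx x0] [Wy y0]; split; first exact: WP.
  by rewrite linearP x0 y0 scaler0 addr0.
have [c hc] : exists c : 'I_n -> F, forall v, W' v ->
    g v = \sum_(i < n) c i * phi (lift ord0 i) v.
  apply: IHn sW' _ => v [Wv v0] vi; apply: gK => // i.
  by have [j ->|->] := unliftP ord0 i.
pose h v := g v - \sum_(i < n) c i * phi (lift ord0 i) v.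
have hP k x y : h (k *: x + y) = k * h x + h y.
  rewrite /h linearP /=.
  under eq_bigr do rewrite linearP mulrDr /= mulrCA.
  rewrite big_split /= -mulr_sumr -[k *: g x]/(k * g x); ring.
suff [d hd] : exists d, forall v, W v -> h v = d * phi ord0 v.
  exists (fun i => oapp c d (unlift ord0 i)) => v Wv.
  rewrite big_ord_recl unlift_none /= -hd// /h.
  under [in RHS]eq_bigr do rewrite liftK /=.
  by rewrite subrK.
have h0 v : W v -> phi ord0 v = 0 -> h v = 0.
  by move=> Wv v0; rewrite /h hc ?subrr.
(* A vector [v0] off the kernel of the first functional fixes the multiple. If there is none, [h]
   vanishes on [W] and the multiple 0 serves. *)
have [[v0 [Wv0 v0N0]]|/forallNP all0] :=
    pselect (exists v0, W v0 /\ phi ord0 v0 != 0).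
  exists (h v0 / phi ord0 v0) => v Wv.
  have v0h : phi ord0 (- (phi ord0 v / phi ord0 v0) *: v0 + v) = 0.
    rewrite linearP /= -[_ *: _]/(_ * _); field.
    exact: v0N0.
  have := h0 _ (WP _ _ _ Wv0 Wv) v0h; rewrite hP => /eqP.
  by rewrite mulNr addrC subr_eq0 => /eqP ->; ring.
exists 0 => v Wv; rewrite mul0r h0//; apply/eqP; apply: contra_notT (all0 v).
by split.
Qed.

End subspaces.

(** * Dual norms, norms of bilinear forms and inf-sup constants *)

Section norms.
Context {R : realType}.

Lemma linear_bounded_byP (V W : normedModType R) (f : {linear V -> W}) :
  continuous f <-> exists2 M : R, 0 <= M & forall v, `|f v| <= M * `|v|.
Proof.
rewrite -linear_bounded_continuous linear_boundedP; split.
  move=> [M [Mr MP]]; exists (Num.max 0 (M + 1)); first by rewrite le_max lexx.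
  by apply: MP; rewrite lt_max ltrDl ltr01 orbT.
move=> [M M0 MP]; exists M; split; first exact: num_real.
move=> N MN v; apply: le_trans (MP v) _.
by rewrite ler_wpM2r// ltW.
Qed.

Lemma sup_ge0 (S : set R) : (forall x, S x -> 0 <= x) -> 0 <= sup S.
Proof.
move=> S0; have [[S1 S2]|nS] := pselect (has_sup S); last by rewrite sup_out.
by have [x Sx] := S1; apply: le_trans (ub_le_sup S2 Sx); exact: S0.
Qed.

Section dual.
Variable V : normedModType R.
Implicit Type f : {linear V -> R}.

Lemma dual_norm_ge0 (f : V -> R) : 0 <= dual_norm f.
Proof. by apply: sup_ge0 => _ [v _ <-]; rewrite divr_ge0. Qed.

Lemma dual_normP f v : continuous f -> `|f v| <= dual_norm f * `|v|.
Proof.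
move=> /linear_bounded_byP[M M0 fM].
have [->|v0] := eqVneq v 0; first by rewrite linear0 !normr0 mulr0.
rewrite -ler_pdivrMr ?normr_gt0//; apply: ub_le_sup; last by exists v.
by exists M => _ [u u0 <-]; rewrite ler_pdivrMr ?normr_gt0.
Qed.

Lemma dual_norm_le (f : V -> R) (M : R) :
  0 <= M -> (forall v, `|f v| <= M * `|v|) -> dual_norm f <= M.
Proof.
move=> M0 fM; rewrite /dual_norm; set S := [set _ | _ in _].
have SM : ubound S M by move=> _ [u u0 <-]; rewrite ler_pdivrMr ?normr_gt0.
(* On a trivial space [S] is empty, its [sup] is 0, and [0 <= M] concludes. *)
have [S0|nS] := pselect (S !=set0); first exact: sup_le_ub.
by rewrite sup_out// => -[].
Qed.

End dual.

(** Continuity at the origin keeps [|c|] at most 1 on a ball of radius [d]. Scaling both arguments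
    to norm [e < d] yields the constant [e^-2]. *)
Lemma continuous_bilinear_bounded (U V : normedModType R)
    (c : {bilinear U -> V -> R}) : continuous_bilinear c ->
  exists2 M, 0 <= M & forall u v, `|c u v| <= M * (`|u| * `|v|).
Proof.
move=> /(_ (0, 0)) /= /cvgrPdist_le /(_ 1 ltr01); rewrite linear0l.
move=> /nbhs_ballP[d /= d0 dP].
have [e e0 ed] : exists2 e, 0 < e & e < d.
  by exists (d / 2); rewrite ?divr_gt0// ltr_pdivrMr//; lra.
have small (W : normedModType R) (w : W) :
    w != 0 -> ball (0 : W) d ((e / `|w|) *: w).
  move=> w0; rewrite -ball_normE /ball_ /= sub0r normrN normrZ.
  rewrite normrM normrV ?unitfE ?normr_eq0// normr_id (gtr0_norm e0).
  by rewrite divfK ?normr_eq0.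
exists (e^-1 ^+ 2); first exact: sqr_ge0.
move=> u v.
have [->|u0] := eqVneq u 0; first by rewrite linear0l !normr0 mul0r mulr0.
have [->|v0] := eqVneq v 0; first by rewrite linear0r !normr0 !mulr0.
have := dP ((e / `|u|) *: u, (e / `|v|) *: v) (conj (small _ _ u0) (small _ _ v0)).
rewrite /= sub0r normrN linearZl_LR linearZr_LR /= !normrM !normfV !normr_id.
rewrite (gtr0_norm e0).
have nu : 0 < `|u| by rewrite normr_gt0.
have nv : 0 < `|v| by rewrite normr_gt0.
rewrite mulrA -ler_pdivlMl ?mulr_gt0 ?invr_gt0//.
rewrite mulr1 => /le_trans; apply; rewrite le_eqVlt; apply/orP; left.
by apply/eqP; field; rewrite !gt_eqF.
Qed.

Lemma bilinear_norm_ge0 (U V : normedModType R) (c : U -> V -> R) :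
  0 <= bilinear_norm c.
Proof.
apply: sup_ge0 => _ [u [v [_ _ ->]]].
by rewrite divr_ge0// mulr_ge0.
Qed.

Lemma bilinear_normP (U V : normedModType R) (c : {bilinear U -> V -> R}) u v :
  continuous_bilinear c -> `|c u v| <= bilinear_norm c * (`|u| * `|v|).
Proof.
move=> /continuous_bilinear_bounded[M M0 cM].
have [->|u0] := eqVneq u 0; first by rewrite linear0l !normr0 mul0r mulr0.
have [->|v0] := eqVneq v 0; first by rewrite linear0r !normr0 !mulr0.
rewrite -ler_pdivrMr ?mulr_gt0 ?normr_gt0//; apply: ub_le_sup; last by exists u, v.
exists M => _ [u' [v' [u'0 v'0 ->]]].
by rewrite ler_pdivrMr ?mulr_gt0 ?normr_gt0.
Qed.

Lemma continuous_bilinear_linear (U V : normedModType R)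
    (c : {bilinear U -> V -> R}) u :
  continuous_bilinear c -> continuous (c u).
Proof.
move=> cc; apply/linear_bounded_byP; exists (bilinear_norm c * `|u|).
  by rewrite mulr_ge0// bilinear_norm_ge0.
by move=> v; rewrite -mulrA; exact: bilinear_normP.
Qed.

Section infsup.
Variables (U V : normedModType R) (c : U -> V -> R) (A : set U) (B : set V).

(** The form in which (A) and (B) are used as hypotheses. The sign of [M] covers [u = 0], which the
    infimum leaves out. *)
Lemma infsup_le alpha M u : (alpha%:E <= infsup c A B)%E -> A u -> 0 <= M ->
  (forall v, B v -> c u v <= M * `|v|) -> alpha * `|u| <= M.
Proof.
move=> /ereal_infP h Au M0 uM.
have [->|u0] := eqVneq u 0; first by rewrite normr0 mulr0.
have nu : 0 < `|u| by rewrite normr_gt0.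
rewrite -ler_pdivlMr// -lee_fin.
apply: le_trans (h _ _) _; first by exists u => //; split=> //; exact/eqP.
apply: ge_ereal_sup => _ [v [Bv /eqP v0] <-].
rewrite lee_fin ler_pdivrMr ?mulr_gt0 ?normr_gt0// mulrA divfK ?gt_eqF//.
exact: uM.
Qed.

(** The form in which (A) and (B) get proved: each nonzero [u] receives its own test vector. *)
Lemma infsup_ge alpha :
  (forall u, A u -> u != 0 ->
     exists v, [/\ B v, v != 0 & alpha * (`|u| * `|v|) <= c u v]) ->
  (alpha%:E <= infsup c A B)%E.
Proof.
move=> h; apply/ereal_infP => _ [u [Au /eqP u0] <-].
have [v [Bv v0 le]] := h u Au u0.
apply: le_ereal_sup_tmp; exists (c u v / (`|u| * `|v|))%:E.
  by exists v => //; split=> //; exact/eqP.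
by rewrite lee_fin ler_pdivlMr// mulr_gt0 ?normr_gt0.
Qed.

End infsup.

End norms.

(** * Hilbert spaces: Cauchy-Schwarz, Riesz and Babuska-Necas *)

Section hilbert.
Context {R : realType}.

Section inner_product.
Variable V : hilbertType R.
Implicit Types x y : V.

Lemma innerC x y : inner x y = inner y x.
Proof. by rewrite hermC /= expr0 mul1r. Qed.

Lemma innerZl k x y : inner (k *: x) y = k * inner x y.
Proof. exact: linearZl_LR. Qed.

Lemma innerZr k x y : inner x (k *: y) = k * inner x y.
Proof. exact: linearZr_LR. Qed.

Lemma cauchy_schwarz x y : `|inner x y| <= `|x| * `|y|.
Proof.
have [->|y0] := eqVneq y 0; first by rewrite linear0r !normr0 mulr0.
have ny : 0 < `|y| ^+ 2 by rewrite exprn_gt0// normr_gt0.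
(* The difference of [x] and its orthogonal projection on the line of [y]. *)
have := sqr_ge0 `|x - (inner x y / `|y| ^+ 2) *: y|.
rewrite -inner_norm linearBr !linearBl /= !innerZl !innerZr (innerC y x).
rewrite !inner_norm => h.
rewrite -ler_sqr ?nnegrE ?mulr_ge0// real_normK ?num_real// exprMn.
rewrite -subr_ge0 -(pmulr_lge0 _ (x := `|y| ^- 2)) ?invr_gt0//.
apply: le_trans h _; rewrite le_eqVlt; apply/orP; left; apply/eqP; field.
by rewrite normr_eq0.
Qed.

Lemma inner_continuous x : continuous (inner x).
Proof. by apply/linear_bounded_byP; exists `|x| => // y; exact: cauchy_schwarz. Qed.

Lemma inner_inj (W : set V) x y : linear_subspace W -> W x -> W y ->
  (forall w, W w -> inner x w = inner y w) -> x = y.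
Proof.
move=> sW Wx Wy xy; apply/eqP; rewrite -subr_eq0 -normr_eq0 -sqrf_eq0 -inner_norm.
by rewrite linearBl /= xy ?subrr//; exact: linear_subspaceB.
Qed.

Lemma dual_norm_inner x : dual_norm (inner x) <= `|x|.
Proof. by apply: dual_norm_le => // y; exact: cauchy_schwarz. Qed.

End inner_product.

Lemma quadratic_discriminant (e D Q : R) : 0 <= Q ->
  (forall t, 0 <= e + t * D *+ 2 + t ^+ 2 * Q) -> D ^+ 2 <= e * Q.
Proof.
rewrite le_eqVlt => /predU1P[<-|Q0] h.
  rewrite mulr0; have [->|D0] := eqVneq D 0; first by rewrite expr0n.
  (* At this [t] the affine function [e + 2 t D] takes the value -1. *)
  have := h (- (e + 1) / (D *+ 2)); rewrite mulr0 addr0.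
  have -> : e + - (e + 1) / (D *+ 2) * D *+ 2 = -1.
    by field.
  by rewrite oppr_ge0 ler10.
(* The minimiser of the parabola. *)
have := h (- D / Q); rewrite -(pmulr_rge0 _ Q0).
have -> : Q * (e + - D / Q * D *+ 2 + (- D / Q) ^+ 2 * Q) = e * Q - D ^+ 2.
  by field; rewrite gt_eqF.
by rewrite subr_ge0.
Qed.

(* The solution minimises [|A v|^2 - 2 f v] over [W]; minimising sequences are
   Cauchy by coercivity. *)
Lemma least_squares (V H : hilbertType R) (W : set V) (A : {linear V -> H})
    (f : {linear V -> R}) (c : R) :
  closed_subspace W -> continuous A -> continuous f -> 0 < c ->
  (forall v, W v -> c * `|v| <= `|A v|) ->
  exists2 r, W r & forall v, W v -> inner (A r) (A v) = f v.
Proof.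
move=> [sW cW] cA cf c0 hA.
have /linear_subspaceP[W0 _] := sW.
pose J v := `|A v| ^+ 2 - f v *+ 2.
have /linear_bounded_byP[M M0 hM] := cf.
have JE v w t : J (v + t *: w) =
    J v + t * (inner (A v) (A w) - f w) *+ 2 + t ^+ 2 * `|A w| ^+ 2.
  have AE : A (v + t *: w) = A v + t *: A w by rewrite linearD linearZ.
  have fE : f (v + t *: w) = f v + t * f w by rewrite linearD linearZ.
  rewrite /J AE fE -!inner_norm linearDr !linearDl /= !innerZl !innerZr.
  by rewrite (innerC (A w) (A v)); ring.
pose E := J @` W.
have E_inf : has_inf E.
  split; first by exists (J 0), 0.
  (* This lower bound comes from completing the square in [(c |v|)^2 - 2 M |v|]. *)
  exists (- (M / c) ^+ 2) => _ [v Wv <-].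
  have h1 : f v *+ 2 <= M * `|v| *+ 2.
    by rewrite lerMn2r; apply: le_trans (hM v); exact: ler_norm.
  have h2 : (c * `|v|) ^+ 2 <= `|A v| ^+ 2.
    by rewrite lerXn2r ?nnegrE ?hA// mulr_ge0// ltW.
  have := sqr_ge0 (c * `|v| - M / c).
  have -> : (c * `|v| - M / c) ^+ 2 = (c * `|v|) ^+ 2 - M * `|v| *+ 2 + (M / c) ^+ 2.
    by field; rewrite gt_eqF.
  rewrite /J; lra.
pose m := inf E.
have J_ge v : W v -> m <= J v.
  by move=> Wv; apply: ge_inf => //; [exact: E_inf.2|exists v].
(* The first variation at a minimiser up to [e] is small: along the line from [v] in direction [w],
   [J - m] is a nonnegative quadratic in [t], with constant term at most [e]. *)
have DE e v w : W v -> W w -> J v <= m + e ->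
    (inner (A v) (A w) - f w) ^+ 2 <= e * `|A w| ^+ 2.
  move=> Wv Ww Jv; apply: quadratic_discriminant => [|t]; first exact: sqr_ge0.
  have : m <= J (v + t *: w).
    by apply: J_ge; apply: linear_subspaceD => //; exact: linear_subspaceZ.
  rewrite JE; lra.
(* In the direction [x = v - w] the first variations [D1] at [v] and [D2] at [w] differ by
   [|A x|^2]. Hence [|A x|^4 <= 2 D1^2 + 2 D2^2 <= 4 e |A x|^2]. *)
have CE e v w : W v -> W w -> J v <= m + e -> J w <= m + e ->
    (c * `|v - w|) ^+ 2 <= e *+ 4.
  move=> Wv Ww Jv Jw; have Wx := linear_subspaceB sW Wv Ww.
  set x := v - w in Wx *.
  have h1 := DE _ _ _ Wv Wx Jv; have h2 := DE _ _ _ Ww Wx Jw.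
  have e0 : 0 <= e by have := J_ge v Wv; lra.
  have hx : `|A x| ^+ 2 = (inner (A v) (A x) - f x) - (inner (A w) (A x) - f x).
    by rewrite -inner_norm {1}/x linearB linearBl /=; ring.
  have : (c * `|x|) ^+ 2 <= `|A x| ^+ 2.
    by rewrite lerXn2r ?nnegrE ?hA// mulr_ge0// ltW.
  move=> /le_trans; apply.
  move: hx h1 h2; set D1 := _ - f x; set D2 := _ - f x; set Q := `|A x| ^+ 2.
  have : 0 <= Q by exact: sqr_ge0.
  rewrite le_eqVlt => /predU1P[<- _ _ _|Q0 QE h1 h2]; first by rewrite mulrn_wge0.
  rewrite -(ler_pM2r Q0).
  have : Q * Q <= D1 ^+ 2 *+ 2 + D2 ^+ 2 *+ 2.
    rewrite {1 2}QE -subr_ge0.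
    have -> : D1 ^+ 2 *+ 2 + D2 ^+ 2 *+ 2 - (D1 - D2) * (D1 - D2) = (D1 + D2) ^+ 2 by ring.
    exact: sqr_ge0.
  lra.
have /choice[u uP] : forall n : nat, exists v, W v /\ J v <= m + n.+1%:R^-1.
  move=> n; have n0 : 0 < n.+1%:R^-1 :> R by rewrite invr_gt0.
  have [_ [v Wv <-] /ltW Jv] := inf_adherent n0 E_inf.
  by exists v.
have u_cauchy : cauchy (u @ \oo).
  apply/cauchy_ballP => e e0.
  (* [CE] turns a gap below [(c * e)^2 / 4] into a distance below [e]. *)
  have : (n.+1%:R^-1 : R) @[n --> \oo] --> (0 : R) by exact: cvg_harmonic.
  move=> /cvgrPdist_lt /(_ ((c * e) ^+ 2 / 4)).
  rewrite divr_gt0 ?exprn_gt0 ?mulr_gt0// => /(_ erefl)[n _ nP].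
  have uball i : (n <= i)%N -> J (u i) <= m + n.+1%:R^-1.
    move=> ni; apply: le_trans (uP i).2 _; rewrite lerD2l.
    by rewrite lef_pV2 ?posrE// ler_nat.
  exists (u @` [set i | (n <= i)%N], u @` [set i | (n <= i)%N]).
    by split; exists n => // i /= ni; exists i.
  move=> [_ _] [[i /= ni <-] [j /= nj <-]] /=.
  rewrite -ball_normE /ball_ /=.
  have := CE _ _ _ (uP i).1 (uP j).1 (uball _ ni) (uball _ nj).
  have := nP n (leqnn n); rewrite /= sub0r normrN gtr0_norm ?invr_gt0// => h1 h2.
  rewrite -(ltr_pM2l c0) -ltr_sqr ?nnegrE ?mulr_ge0 ?(ltW c0) ?(ltW e0)//.
  by apply: le_lt_trans h2 _; rewrite -(mulr_natr _ 4) -ltr_pdivlMr.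
have /cauchy_cvgP/cvg_ex[r ur] := u_cauchy.
have Wr : W r.
  by apply: (@closed_cvg _ _ _ _ u W cW _ r ur); apply: nearW => n; exact: (uP n).1.
exists r => // v Wv; apply/eqP; rewrite -subr_eq0 -sqrf_eq0; apply/eqP.
(* The squared first variation at [u n] tends to its value at [r] by continuity, and to 0 by
   [DE]. *)
pose D w := (inner (A w) (A v) - f v) ^+ 2.
have cD : D (u n) @[n --> \oo] --> D r.
  have cI : (inner (A v) \o A) x @[x --> r] --> (inner (A v) \o A) r.
    by apply: continuous_comp; [exact: cA|exact: inner_continuous].
  have cB : inner (A v) (A (u n)) - f v @[n --> \oo] --> inner (A v) (A r) - f v.
    by apply: cvgB; [exact: cvg_comp ur cI|exact: cvg_cst].
  rewrite /D innerC expr2; under eq_fun do rewrite innerC expr2.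
  exact: cvgM.
have D0 : D (u n) @[n --> \oo] --> (0 : R).
  apply: (@squeeze_cvgr _ _ _ _ (fun=> 0) (fun n => n.+1%:R^-1 * `|A v| ^+ 2)).
  - by apply: nearW => n; rewrite sqr_ge0/=; apply: DE => //; have [] := uP n.
  - exact: cvg_cst.
  - rewrite -[X in _ --> X](mul0r (`|A v| ^+ 2)); apply: cvgMl.
    exact: cvg_harmonic.
by have /cvg_unique := cD; apply.
Qed.

Lemma riesz (V : hilbertType R) (W : set V) (f : {linear V -> R}) :
  closed_subspace W -> continuous f ->
  exists2 r, W r & forall v, W v -> inner r v = f v.
Proof.
move=> cW cf; apply: (@least_squares _ _ _ idfun _ 1) => // [v|v _].
  exact: cvg_id.
by rewrite mul1r.
Qed.

Lemma bilinear_operator (V : hilbertType R) (W : set V)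
    (a : {bilinear V -> V -> R}) : closed_subspace W -> continuous_bilinear a ->
  exists A : {linear V -> V},
    forall r, W (A r) /\ forall v, W v -> inner (A r) v = a r v.
Proof.
move=> cW ca.
have /choice[A AP] : forall r, exists t, W t /\ forall v, W v -> inner t v = a r v.
  move=> r; have [t Wt tP] := riesz cW (continuous_bilinear_linear (u := r) ca).
  by exists t.
have sW := cW.1.
(* Uniqueness of representers in [W] makes the chosen map linear. *)
have Alin : linear A.
  move=> k x y; apply: (inner_inj sW (AP _).1).
    apply: linear_subspaceD (AP _).1 => //.
    by apply: linear_subspaceZ (AP _).1.
  move=> v Wv; rewrite linearDl /= innerZl.
  by rewrite (AP x).2// (AP y).2// (AP (_ + _)).2// linearDl linearZl_LR.
pose Al : {linear V -> V} := HB.pack A (GRing.isLinear.Build _ _ _ _ A Alin).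
by exists Al.
Qed.

(* The inf-sup condition makes the operator [A] of [a] bounded below on [W], so
   that [|A r - t|^2], with [t] the representer of [f], has a minimiser in [W];
   the residual is then annihilated by the non-degeneracy. *)
Lemma babuska_necas (V : hilbertType R) (W : set V) (a : {bilinear V -> V -> R})
    (alpha : R) (f : {linear V -> R}) :
  closed_subspace W -> continuous_bilinear a -> continuous f -> 0 < alpha ->
  (alpha%:E <= infsup a W W)%E ->
  (forall v, W v -> (forall r, W r -> a r v = 0) -> v = 0) ->
  exists2 r, W r & forall v, W v -> a r v = f v.
Proof.
move=> cW ca cf alpha0 inf_a nondeg; have sW := cW.1.
have [t Wt tP] := riesz cW cf.
have [A AP] := bilinear_operator cW ca.
have cA : continuous A.
  apply/linear_bounded_byP; exists (bilinear_norm a) => [|v].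
    exact: bilinear_norm_ge0.
  have [->|Av0] := eqVneq (A v) 0.
    by rewrite normr0 mulr_ge0// bilinear_norm_ge0.
  (* [A v] lies in [W], so it may be tested against itself: [|A v|^2 = a v (A v)]. *)
  have [WAv AvE] := AP v.
  rewrite -(ler_pM2r (x := `|A v|)) ?normr_gt0// -expr2 -inner_norm AvE//.
  by rewrite -mulrA; apply: le_trans (bilinear_normP _ _ ca); exact: ler_norm.
have [r Wr rP] : exists2 r, W r &
    forall v, W v -> inner (A r) (A v) = (inner t \o A) v.
  apply: (@least_squares _ _ _ A (inner t \o A) alpha) => //.
    by move=> v; apply: continuous_comp; [exact: cA|exact: inner_continuous].
  move=> v Wv; apply: (infsup_le inf_a) => // w Ww.
  by rewrite -(AP v).2//; apply: le_trans (cauchy_schwarz _ _); exact: ler_norm.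
(* By [rP] the residual is orthogonal to [A v] for every [v] in [W], that is [a v (A r - t) = 0]. *)
have Art : A r - t = 0.
  apply: nondeg => [|v Wv]; first by apply: linear_subspaceB => //; exact: (AP r).1.
  rewrite -(AP v).2; last by apply: linear_subspaceB => //; exact: (AP r).1.
  by rewrite linearBr /= innerC rP//= innerC subrr.
exists r => // v Wv; rewrite -(AP r).2// -tP//.
by rewrite -[A r](subrK t) Art add0r.
Qed.

End hilbert.

(** * The discrete kernel and the algebra of the saddle point problem *)

Section saddle_point.
Context {R : realType} {U V : hilbertType R}.
Variables (a : {bilinear V -> V -> R}) (b : {bilinear U -> V -> R}).
Variables (Uh : set U) (Vhat : set V).
Hypotheses (ca : continuous_bilinear a) (cb : continuous_bilinear b).
Hypotheses (fUh : finite_dim_subspace Uh) (cVhat : closed_subspace Vhat).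
Implicit Types f g : {linear V -> R}.

Local Notation K := (discrete_kernel b Uh Vhat).
Local Notation solves := (solves a b Uh Vhat).

Lemma finite_dim_linear_subspace : linear_subspace Uh.
Proof.
have [n [e ->]] := fUh; apply/linear_subspaceP; split.
  by exists (fun=> 0) => //; rewrite big1// => i _; rewrite scale0r.
move=> k _ _ [c _ <-] [d _ <-]; exists (fun i => k * c i + d i) => //.
rewrite scaler_sumr -big_split/=; apply: eq_bigr => i _.
by rewrite scalerDl scalerA.
Qed.

Lemma discrete_kernel_closed_subspace : closed_subspace K.
Proof.
have [sV cV] := cVhat; have /linear_subspaceP[V0 VP] := sV.
split.
  apply/linear_subspaceP; split; first by split=> // w _; rewrite linear0r.
  move=> k x y [Vx Kx] [Vy Ky]; split; first exact: VP.
  by move=> w Uw; rewrite linearPr Kx// Ky// scaler0 addr0.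
have -> : K = Vhat `&` \bigcap_(w in Uh) (b w @^-1` [set 0]).
  by apply/seteqP; split=> v [Vv Kv]; split.
apply: closedI => //; apply: closed_bigI => w _.
apply: closed_comp; last exact: closed_eq.
by move=> v _; exact: continuous_bilinear_linear.
Qed.

(** Finite dimension stands in for the closed range theorem: [K] is the part of [Vhat] where all
    [b (e i)] vanish, so [g] is a combination of them on [Vhat], and the coefficients assemble
    [w]. *)
Lemma annihilator_discrete_kernel g : (forall v, K v -> g v = 0) ->
  exists2 w, Uh w & forall v, Vhat v -> b w v = g v.
Proof.
move=> gK; have [n [e UhE]] := fUh.
have Ue i : Uh (e i).
  rewrite UhE; exists (fun j => (j == i)%:R) => //.
  rewrite (bigD1 i)//= eqxx scale1r big1 ?addr0// => j /negbTE ->.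
  by rewrite scale0r.
have [c cP] : exists c : 'I_n -> R,
    forall v, Vhat v -> g v = \sum_(i < n) c i * b (e i) v.
  apply: (functional_sum (phi := fun i => b (e i))) cVhat.1 _ => v Vv v0.
  apply: gK; split => // w; rewrite UhE => -[d _ <-].
  by rewrite linear_sumlz big1// => i _; rewrite linearZl_LR /= v0 scaler0.
exists (\sum_(i < n) c i *: e i); first by rewrite UhE; exists c.
move=> v Vv; rewrite cP// linear_sumlz; apply: eq_bigr => i _.
by rewrite linearZl_LR.
Qed.

Lemma solves_kernel f p : solves f p -> K p.1.
Proof. by case=> ? _ _ ?; split. Qed.

Lemma solves_combination k f g p q :
  solves f p -> solves g q -> solves (k \*: f \+ g) (k *: p + q).
Proof.
move=> [Vp Up fp Kp] [Vq Uq gq Kq].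
have /linear_subspaceP[_ VP] := cVhat.1.
have /linear_subspaceP[_ UP] := finite_dim_linear_subspace.
split => /=; [exact: VP|exact: UP| |].
- move=> v Vv; rewrite !linearPl -fp// -gq// /= -[_ *: a _ _]/(_ * _).
  by rewrite -[_ *: b _ _]/(_ * _) -[_ *: _]/(_ * _); ring.
- by move=> w Uw; rewrite linearPr Kp// Kq// scaler0 addr0.
Qed.

(** * Sufficiency of (A) and (B), with the a priori bounds *)

Section stability.
Variables alpha beta : R.
Hypotheses (alpha0 : 0 < alpha) (beta0 : 0 < beta).
Hypotheses (hA : condA a b Uh Vhat alpha) (hB : condB b Uh Vhat beta).

(** Tested within the kernel, the first equation loses its [b] term, so (A) applies to [r] alone. *)
Lemma saddle_primal_bound f p : continuous f -> solves f p ->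
  `|p.1| <= alpha^-1 * dual_norm f.
Proof.
move=> cf fp; rewrite ler_pdivlMl//.
apply: (infsup_le hA.1 (solves_kernel fp)); first exact: dual_norm_ge0.
have [_ Up fE _] := fp => v [Vv Kv].
have := fE v Vv; rewrite Kv// addr0 => ->.
by apply: le_trans (dual_normP _ cf); exact: ler_norm.
Qed.

(** On [Vhat], [b u_h = f - a r]. The triangle inequality and [saddle_primal_bound] estimate the
    right side, and (B) passes the estimate to [u_h]. *)
Lemma saddle_multiplier_bound f p : continuous f -> solves f p ->
  `|p.2| <= beta^-1 * (1 + bilinear_norm a / alpha) * dual_norm f.
Proof.
move=> cf fp; have [_ Up fE _] := fp.
rewrite -mulrA ler_pdivlMl//.
apply: (infsup_le hB Up).
  by rewrite mulr_ge0 ?dual_norm_ge0// addr_ge0// divr_ge0 ?bilinear_norm_ge0// ltW.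
move=> v Vv; have -> : b p.2 v = f v - a p.1 v by rewrite -fE//; ring.
apply: le_trans (ler_norm _) _; apply: le_trans (ler_normB _ _) _.
rewrite mulrDl mul1r mulrDl; apply: lerD; first exact: dual_normP.
apply: le_trans (bilinear_normP _ _ ca) _.
rewrite mulrA ler_wpM2r// -mulrA ler_wpM2l ?bilinear_norm_ge0//.
exact: saddle_primal_bound.
Qed.

Lemma saddle_exists f : continuous f -> exists p, solves f p.
Proof.
move=> cf.
have [r Kr rP] : exists2 r, K r & forall v, K v -> a r v = f v.
  apply: (babuska_necas (alpha := alpha)) => //.
  - exact: discrete_kernel_closed_subspace.
  - exact: hA.1.
  - move=> v Kv v0; have := hA.2; rewrite eqEsubset => -[+ _].
    by apply; split.
have [w Uw wP] := @annihilator_discrete_kernel (f \- a r)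
  (fun v Kv => etrans (congr1 (fun x => f v - x) (rP v Kv)) (subrr _)).
exists (r, w); split=> //=; first exact: Kr.1; last exact: Kr.2.
by move=> v Vv; rewrite wP//= addrC subrK.
Qed.

Lemma stable_well_posed : well_posed a b Uh Vhat.
Proof.
(* The product norm is a maximum, so the sum of the two stability constants dominates both
   components. *)
pose C := alpha^-1 + beta^-1 * (1 + bilinear_norm a / alpha).
have C2 : 0 <= beta^-1 * (1 + bilinear_norm a / alpha).
  rewrite mulr_ge0 ?invr_ge0 ?(ltW beta0)// addr_ge0// divr_ge0 ?(ltW alpha0)//.
  exact: bilinear_norm_ge0.
have C0 : 0 < C by rewrite ltr_pwDl ?invr_gt0.
(* By linearity the bounds apply to differences: the solution map is Lipschitz, and [g = f] gives
   uniqueness. *)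
have bound f g p q : continuous f -> continuous g -> solves f p -> solves g q ->
    `|q - p| <= C * dual_norm (fun v => g v - f v).
  move=> cf cg fp gq.
  pose h := (-1 \*: f \+ g : {linear V -> R}).
  have ch : continuous h.
    move=> v; apply: cvgD; last exact: cg.
    by apply: cvgZr; exact: cf.
  have -> : (fun v => g v - f v) = h.
    by apply/funext => v; rewrite /h /= scaleN1r addrC.
  have := solves_combination (-1) fp gq; rewrite scaleN1r addrC.
  rewrite -/h => hs; have d0 := dual_norm_ge0 h.
  rewrite prod_normE ge_max; apply/andP; split.
    apply: le_trans (saddle_primal_bound ch hs) _.
    by rewrite ler_wpM2r// lerDl.
  apply: le_trans (saddle_multiplier_bound ch hs) _.
  by rewrite ler_wpM2r// lerDr invr_ge0 ltW.
split=> [f cf|f p cf fp eps eps0].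
  have [p fp] := saddle_exists cf; exists p; split=> // q fq.
  have := bound _ _ _ _ cf cf fq fp.
  have -> : dual_norm (fun v => f v - f v) = 0.
    apply/eqP; rewrite eq_le dual_norm_ge0 andbT dual_norm_le// => v.
    by rewrite subrr normr0 mul0r.
  by rewrite mulr0 normr_le0 subr_eq0 => /eqP.
exists (eps / C); first by rewrite divr_gt0.
move=> g q cg gq; rewrite ltr_pdivlMr// mulrC; apply: le_lt_trans.
exact: bound.
Qed.

End stability.

(** * Necessity of (A) and (B) *)

Section necessity.
Hypothesis wp : well_posed a b Uh Vhat.

Lemma continuous_linear0 : continuous (\0 : {linear V -> R}).
Proof. by move=> v; exact: cvg_cst. Qed.

Lemma solves0 : solves (\0 : {linear V -> R}) 0.
Proof.
have /linear_subspaceP[V0 _] := cVhat.1.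
have /linear_subspaceP[U0 _] := finite_dim_linear_subspace.
split=> //= [v _|w _]; first by rewrite !linear0l addr0.
by rewrite linear0r.
Qed.

(** Continuity at the zero datum with [eps = 1] gives a radius [d], and every datum is scaled into
    that ball. Scaling to norm [d / 2] keeps the inequality strict, whence the constant [2 / d]. *)
Lemma well_posed_bound : exists2 C, 0 < C &
  forall f p, continuous f -> solves f p -> `|p| <= C * dual_norm f.
Proof.
have [d d0 dP] := wp.2 _ _ continuous_linear0 solves0 _ ltr01.
exists (2 / d) => [|f p cf fp]; first by rewrite divr_gt0.
have scaled k : 0 <= k -> k * dual_norm f < d -> k * `|p| < 1.
  move=> k0 kd; pose h := (k \*: f \+ \0 : {linear V -> R}).
  have ch : continuous h.
    move=> v; apply: cvgD; last exact: cvg_cst.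
    by apply: cvgZr; exact: cf.
  have := solves_combination k fp solves0; rewrite addr0 -/h => hs.
  have := dP h _ ch hs; rewrite subr0 normrZ ger0_norm//; apply.
  apply: le_lt_trans kd; apply: dual_norm_le.
    by rewrite mulr_ge0// dual_norm_ge0.
  move=> v; rewrite /h /= addr0 subr0 normrM (ger0_norm k0) -mulrA.
  by rewrite ler_wpM2l// dual_normP.
have := dual_norm_ge0 f; rewrite le_eqVlt => /predU1P[f0|f0].
  (* When [f] has norm 0 all its multiples stay in the ball, and the factor [|p|^-1] would give
     [1 < 1]. *)
  have [->|p0] := eqVneq p 0.
    by rewrite normr0 mulr_ge0 ?dual_norm_ge0// divr_ge0// ltW.
  have := scaled `|p|^-1; rewrite -f0 mulr0 invr_ge0 normr_ge0 => /(_ erefl d0).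
  by rewrite mulVf ?normr_eq0// ltxx.
have k0 : 0 < d / (2 * dual_norm f) by rewrite divr_gt0// mulr_gt0.
have := scaled _ (ltW k0).
have -> : d / (2 * dual_norm f) * dual_norm f = d / 2.
  by field; rewrite gt_eqF.
have d2 : d / 2 < d by rewrite ltr_pdivrMr//; lra.
move=> /(_ d2) /ltW; rewrite -ler_pdivlMl// mulr1 invfM invrK.
by rewrite [2 / d]mulrC mulrA.
Qed.

Lemma well_posed_infsup_b C : 0 < C ->
  (forall f p, continuous f -> solves f p -> `|p| <= C * dual_norm f) ->
  condB b Uh Vhat C^-1.
Proof.
move=> C0 bound; apply: infsup_ge => w Uw w0.
have [t Vt tP] := riesz cVhat (continuous_bilinear_linear (u := w) cb).
have /linear_subspaceP[V0 _] := cVhat.1.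
have sol : solves (inner t) (0, w).
  split=> //= [v Vv|u _]; first by rewrite linear0l add0r tP.
  by rewrite linear0r.
have := bound _ _ (@inner_continuous _ _ t) sol.
rewrite prod_normE ge_max => /andP[_ /= wC].
have {}wC : `|w| <= C * `|t|.
  by apply: le_trans wC _; rewrite ler_pM2l// dual_norm_inner.
have t0 : t != 0.
  by apply: contraNneq w0 => t0; move: wC; rewrite t0 normr0 mulr0 normr_le0.
(* The test vector is the representer: [b w t = |t|^2], while [|w| <= C |t|]. *)
exists t; split=> //; rewrite -tP// inner_norm mulrA expr2 ler_wpM2r//.
by rewrite ler_pdivrMl.
Qed.

Lemma well_posed_infsup_a C : 0 < C ->
  (forall f p, continuous f -> solves f p -> `|p| <= C * dual_norm f) ->
  condA a b Uh Vhat C^-1.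
Proof.
move=> C0 bound; have cK := discrete_kernel_closed_subspace.
have /linear_subspaceP[K0 _] := cK.1.
split.
  apply: infsup_ge => r Kr r0.
  have [t Kt tP] := riesz cK (continuous_bilinear_linear (u := r) ca).
  (* [inner t - a r] vanishes on the kernel, so a multiplier [w] extends the equation from the
     kernel to [Vhat]. *)
  have [w Uw wP] := @annihilator_discrete_kernel (inner t \- a r)
    (fun v Kv => etrans (congr1 (fun x => x - a r v) (tP v Kv)) (subrr _)).
  have sol : solves (inner t) (r, w).
    split=> //=; [exact: Kr.1| |exact: Kr.2].
    by move=> v Vv; rewrite wP//= addrC subrK.
  have := bound _ _ (@inner_continuous _ _ t) sol.
  rewrite prod_normE ge_max => /andP[/= rC _].
  have {}rC : `|r| <= C * `|t|.
    by apply: le_trans rC _; rewrite ler_pM2l// dual_norm_inner.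
  have t0 : t != 0.
    by apply: contraNneq r0 => t0; move: rC; rewrite t0 normr0 mulr0 normr_le0.
  exists t; split=> //; rewrite -tP// inner_norm mulrA expr2 ler_wpM2r//.
  by rewrite ler_pdivrMl.
apply/seteqP; split=> [v [Kv v0]|_ ->]; last first.
  by split=> // v _; rewrite linear0r.
(* Solve with datum [inner v] and test with [v]: [a r v] vanishes by the assumption on [v], and
   [b w v] because [v] is in the kernel, which leaves [|v|^2 = 0]. *)
have [[r w] [sol _]] := wp.1 _ (@inner_continuous _ _ v).
have := solves_kernel sol; have [_ /= Uw + _] := sol.
move=> /(_ v Kv.1) + Kr; rewrite v0// Kv.2// addr0 inner_norm => /esym/eqP.
by rewrite sqrf_eq0 normr_eq0 => /eqP.
Qed.

End necessity.

Lemma well_posed_iff : well_posed a b Uh Vhat <->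
  exists alpha beta, [/\ 0 < alpha, 0 < beta,
    condA a b Uh Vhat alpha & condB b Uh Vhat beta].
Proof.
split=> [wp|[alpha [beta [alpha0 beta0 hA hB]]]].
  have [C C0 CP] := well_posed_bound wp.
  exists C^-1, C^-1; split; rewrite ?invr_gt0//.
    exact: well_posed_infsup_a.
  exact: well_posed_infsup_b.
exact: stable_well_posed hA hB.
Qed.

(** * The symmetric coercive case *)

Section equivalent_inner_product.
Variables C1 C2 : R.
Hypothesis eqv : equivalent_inner_product a C1 C2.

Lemma equivalent_inner_product_sqr v :
  (C1 * `|v|) ^+ 2 <= a v v <= (C2 * `|v|) ^+ 2.
Proof.
have [[d ad] C10 C20 /(_ v) /andP[h1 h2]] := eqv.
(* [Num.sqrt] is 0 on negative numbers, so the square of the energy norm gives back [a v v] by way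
   of this sign. *)
have avv : 0 <= a v v.
  rewrite ad; have [->|v0] := eqVneq v 0; first by rewrite linear0l.
  by rewrite ltW// neq0_dnorm_gt0.
rewrite -(sqr_sqrtr avv) -/(energy_norm a v).
by rewrite !lerXn2r ?nnegrE ?sqrtr_ge0 ?mulr_ge0// ltW.
Qed.

(** Coercivity gives both halves of (A): each [v] is its own test vector, and [a v v = 0] forces
    [v = 0]. *)
Lemma equivalent_inner_product_condA : condA a b Uh Vhat (C1 ^+ 2).
Proof.
have [_ C10 _ _] := eqv.
have /linear_subspaceP[K0 _] := discrete_kernel_closed_subspace.1.
split.
  apply: infsup_ge => v Kv v0; exists v; split=> //.
  by rewrite -expr2 -exprMn; have /andP[] := equivalent_inner_product_sqr v.
apply/seteqP; split=> [v [Kv /(_ v Kv) v0]|_ ->]; last first.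
  by split=> // v _; rewrite linear0r.
have /andP[+ _] := equivalent_inner_product_sqr v.
rewrite v0 => h; apply/eqP; rewrite -normr_eq0 -(mulrI_eq0 _ (lregP (lt0r_neq0 C10))).
by rewrite -sqrf_eq0 eq_le h sqr_ge0.
Qed.

(* [f - a r] vanishes on [r], hence equals [f] on the [a]-orthogonal projection
   of [v] along [r], whose energy norm does not exceed that of [v]. *)
Lemma energy_residual_bound f r v : continuous f -> a r r = f r ->
  `|f v - a r v| <= C2 / C1 * dual_norm f * `|v|.
Proof.
move=> cf arr; have [[d ad] C10 C20 _] := eqv.
have aC x y : a x y = a y x by rewrite !ad hermC /= expr0 mul1r.
have aZl k x y : a (k *: x) y = k * a x y by exact: linearZl_LR.
have [z zle ->] : exists2 z, a z z <= a v v & f v - a r v = f z.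
  have [->|r0] := eqVneq r 0; first by exists v; rewrite // linear0l subr0.
  have arr0 : 0 < a r r by rewrite ad neq0_dnorm_gt0.
  pose t := a r v / a r r.
  have vE : f (v - t *: r) = f v - t * f r by rewrite linearB linearZ.
  exists (v - t *: r); last by rewrite vE -arr divfK ?gt_eqF.
  have -> : a (v - t *: r) (v - t *: r) = a v v - t ^+ 2 * a r r.
    rewrite linearBr !linearBl /= !aZl !(aC _ (t *: r)) !aZl /t.
    by field; rewrite gt_eqF.
  by rewrite gerBl mulr_ge0 ?sqr_ge0// ltW.
(* The ratio [C2 / C1] arises here: the energy norm is bounded below at [z] and above at [v]. *)
have zv : C1 * `|z| <= C2 * `|v|.
  rewrite -ler_sqr ?nnegrE ?mulr_ge0 ?(ltW C10) ?(ltW C20)//.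
  have /andP[h1 _] := equivalent_inner_product_sqr z.
  have /andP[_ h2] := equivalent_inner_product_sqr v.
  exact: le_trans h1 (le_trans zle h2).
apply: le_trans (dual_normP _ cf) _.
rewrite [_ * dual_norm f]mulrC -mulrA ler_wpM2l ?dual_norm_ge0//.
by rewrite mulrAC ler_pdivlMr// mulrC.
Qed.

(** The residual [f - a r] is estimated as a whole instead of by the triangle inequality. Testing
    the first equation with [r], which lies in the kernel, gives the identity [a r r = f r] that
    this estimate rests on. *)
Lemma energy_multiplier_bound beta f p : 0 < beta -> condB b Uh Vhat beta ->
  continuous f -> solves f p -> `|p.2| <= C2 / C1 * beta^-1 * dual_norm f.
Proof.
move=> beta0 hB cf fp; have [Vp Up fE Kp] := fp; have [_ C10 C20 _] := eqv.
rewrite [C2 / C1 * _]mulrC -mulrA ler_pdivlMl//.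
apply: (infsup_le hB Up).
  by rewrite mulr_ge0 ?dual_norm_ge0// divr_ge0// ltW.
move=> v Vv; have -> : b p.2 v = f v - a p.1 v by rewrite -fE//; ring.
apply: le_trans (ler_norm _) _; apply: energy_residual_bound => //.
by rewrite -fE// Kp// addr0.
Qed.

End equivalent_inner_product.

End saddle_point.

Theorem proposition2p9 (R : realType) (X U V : hilbertType R)
    (a : X -> {bilinear V -> V -> R}) (b : {bilinear U -> V -> R})
    (Uh : set U) (Vhat : set V)
    (ha : forall xi, continuous_bilinear (a xi))
    (hb : continuous_bilinear b)
    (hUh : finite_dim_subspace Uh) (hVhat : closed_subspace Vhat) :
  [/\ forall xi : X,
        well_posed (a xi) b Uh Vhat <->
        exists alpha beta : R, [/\ 0 < alpha, 0 < beta,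
          condA (a xi) b Uh Vhat alpha & condB b Uh Vhat beta],
      forall (xi : X) (alpha beta : R), 0 < alpha -> 0 < beta ->
        condA (a xi) b Uh Vhat alpha -> condB b Uh Vhat beta ->
        forall f : {linear V -> R}, continuous f ->
        forall (r : V) (uh : U), solves (a xi) b Uh Vhat f (r, uh) ->
        `|uh| <= beta^-1 * (1 + bilinear_norm (a xi) / alpha) * dual_norm f
    & forall (xi : X) (C1 C2 : R), equivalent_inner_product (a xi) C1 C2 ->
        condA (a xi) b Uh Vhat (C1 ^+ 2) /\
        forall beta : R, 0 < beta -> condB b Uh Vhat beta ->
        forall f : {linear V -> R}, continuous f ->
        forall (r : V) (uh : U), solves (a xi) b Uh Vhat f (r, uh) ->
        `|uh| <= C2 / C1 * beta^-1 * dual_norm f].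
Proof.
split=> [xi|xi alpha beta alpha0 beta0 hA hB f cf r uh fp|xi C1 C2 eqv].
- exact: well_posed_iff.
- by have := saddle_multiplier_bound (ha xi) alpha0 beta0 hA hB cf fp.
- split=> [|beta beta0 hB f cf r uh fp].
    exact: (equivalent_inner_product_condA Uh hb hVhat eqv).
  by have := energy_multiplier_bound eqv beta0 hB cf fp.
Qed.
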